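(* Let $f=\sum_{i=1}^n\gamma_iu_i$ with $\gamma_i\neq0$, $\lambda_i>0$ and $u_i$ eigenvectors, i.e. $\lambda_iu_i\in\partial J(u_i)$, such that $\langle u_i,u_j\rangle=0$ for $i\ne j$. Put $p_k:=\sum_{i=k}^n\operatorname{sgn}(\gamma_i)\lambda_iu_i$ and assume $p_k\in K:=\partial J(0)$ for $k=1,\dots,n$, and assume $|\gamma_i|/\lambda_i<|\gamma_{i+1}|/\lambda_{i+1}$ for $i=1,\dots,n-1$. For $\tau>0$ let $v_\tau$ be the minimizer of $F_\tau(\cdot;f)$, $v_0:=f$, and $R(\tau):=\|v_\tau-f\|_{\mathcal H}$. Put $\tau_0:=0$, $\tau_k:=|\gamma_k|/\lambda_k$, $t_0:=0$ and $t_k:=T(\tau_k)=\tau_k/R(\tau_k)$ for $k=1,\dots,n$. Then the minimizer $u_t$ of $E_t(\cdot;f)$ is $u_t=v_{S(t)}$, where $S$ is given by $$S(t)=\frac{t\sqrt{\sum_{i=1}^{k-1}\gamma_i^2\|u_i\|_{\mathcal H}^2}}{\sqrt{1-t^2\|p_k\|_{\mathcal H}^2}},\qquad t_{k-1}<t\le t_k,\quad k=1,\dots,n,$$ with $S(t):=0$ if $k=1$.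
   Context: Setting: $\mathcal X\hookrightarrow\mathcal H\hookrightarrow\mathcal X^*$ is a Gelfand triple, where $\mathcal X$ is the (real) Banach space dual of a separable Banach space, $\mathcal H$ is a real Hilbert space, and the continuous embedding $A:\mathcal X\to\mathcal H$ is omitted in the notation. $J:\mathcal X\to[0,\infty]$ is convex, proper, weak$^*$ lower semi-continuous and absolutely one-homogeneous ($J(cu)=|c|J(u)$); $\mathcal N(J)=\{u:J(u)=0\}$; $\partial J(u)=\{p\in\mathcal X^*: J(u)+\langle p,v-u\rangle\le J(v)\ \forall v\in\mathcal X\}$, so $\partial J(0)=\{p\in\mathcal X^*:\langle p,v\rangle\le J(v)\ \forall v\in\mathcal X\}$. The datum $f$ satisfies $J(f)\neq 0$. $F_\tau(v;f)=\frac12\|v-f\|_{\mathcal H}^2+\tau J(v)$ and $E_t(u;f)=\|u-f\|_{\mathcal H}+tJ(u)$, for $u,v\in\mathcal X$, and $T(\tau)=\tau/R(\tau)$ for $\tau>0$. Standing assumptions: (1) the norms $\|\cdot\|_{\mathcal H}$ and $\|\cdot\|_{\mathcal X}$ are equivalent on $\mathcal N(J)$. (2) There is $C>0$ with $\|u-\mathcal P(u)\|_{\mathcal X}\le CJ(u)$ for all $u\in\mathcal X$, where $\mathcal P(u)$ is the minimizer of $\|w-u\|_{\mathcal H}$ over $w\in\mathcal N(J)$. (3) weak$^*$ convergence in $\mathcal X$ implies weak convergence in $\mathcal H$. Eigenvectors are understood to be nonzero.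
   Formalization: At t = t_1 the minimizer of E_t is not unique (every v_τ with 0 ≤ τ ≤ τ_1 minimizes it), so there the theorem says only that v_{S(t)} = f is a minimizer; for every other t in ]0, t_n] it is proved to be the unique minimizer. *)

(* Defs.v *)
From mathcomp Require Import all_boot all_order all_algebra.
From mathcomp Require Import all_classical all_reals all_analysis.

Set Implicit Arguments.
Unset Strict Implicit.
Unset Printing Implicit Defensive.

Import Order.TTheory GRing.Theory Num.Theory.
Import numFieldNormedType.Exports.

Local Open Scope classical_set_scope.
Local Open Scope ring_scope.

Definition separable (T : topologicalType) : Prop :=
  exists2 D : set T, countable D & dense D.

Definition topological_dual (R : realType) (V : normedModType R) :
    set (V -> R) :=
  [set p : V -> R | scalar p /\ continuous p].

(* [X] is the Banach dual of [X0]: the pairing [ev] is a linear isometric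
   bijection from [X] onto the topological dual of [X0] with its operator norm
   (injectivity follows from the norm identity). *)
Record is_dual_of (R : realType) (X0 X : normedModType R)
    (ev : X -> X0 -> R) : Prop := {
  ev_dual : forall u, topological_dual (ev u);
  ev_surj : forall p, topological_dual p -> exists u, ev u = p;
  ev_linear : forall (a : R) (u v : X) (x : X0),
    ev (a *: u + v) x = a * ev u x + ev v x;
  ev_norm : forall u, `|u| = sup [set `|ev u x| | x in [set x | `|x| <= 1]]
}.

Definition weakstar (R : realType) (X0 X : normedModType R)
    (ev : X -> X0 -> R) : topologicalType :=
  initial_topology (ev : X -> {ptws X0 -> R}).

Definition weakstar_cvg (R : realType) (X0 X : normedModType R)
    (ev : X -> X0 -> R) (w : nat -> X) (u : X) : Prop :=
  (w : nat -> weakstar ev) @ \oo --> (u : weakstar ev).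

Definition weak_cvg (R : realType) (V : normedModType R)
    (w : nat -> V) (u : V) : Prop :=
  forall p, topological_dual p -> p (w n) @[n --> \oo] --> p u.

(* With [ip] a dot product on a complete normed space, this says that the
   space is Hilbert. *)
Definition norm_induced_by (R : realType) (H : normedModType R)
    (ip : {dot H for idfun}) : Prop :=
  forall h : H, `|h| ^+ 2 = ip h h.

(* The continuous embedding of a Gelfand triple. Density of the range is what
   makes the embedding [riesz] of [H] into the dual of [X] injective. *)
Record gelfand_embedding (R : realType) (X H : normedModType R)
    (A : {linear X -> H}) : Prop := {
  gelfand_continuous : continuous A;
  gelfand_injective : injective A;
  gelfand_dense : dense (range A)
}.

(* The embedding of [H] into the dual of [X]. *)
Definition riesz (R : realType) (X H : normedModType R)
    (ip : {dot H for idfun}) (A : {linear X -> H}) (h : H) : X -> R :=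
  fun v => ip h (A v).

Section functionals.
Context {R : realType} {X : normedModType R}.
Local Open Scope ereal_scope.

Definition convex_functional (J : X -> \bar R) : Prop :=
  forall (u v : X) (s : R), (0 <= s <= 1)%R ->
    J (s *: u + (1 - s) *: v)%R <= s%:E * J u + (1 - s)%:E * J v.

(* For functionals with values in [0, +oo]. *)
Definition proper_functional (J : X -> \bar R) : Prop := exists u, J u < +oo.

(* For [c = 0] and [J u = +oo] this uses [0 * +oo = 0]. *)
Definition abs_homogeneous (J : X -> \bar R) : Prop :=
  forall (c : R) (u : X), J (c *: u)%R = `|c|%:E * J u.

Definition null_set (J : X -> \bar R) : set X := [set u | J u = 0].

Definition subdiff (J : X -> \bar R) (u : X) : set (X -> R) :=
  [set p | topological_dual p /\ forall v, J u + (p (v - u)%R)%:E <= J v].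

Definition argmin (D : set X) (G : X -> \bar R) : set X :=
  [set w | D w /\ forall v, D v -> G w <= G v].

End functionals.

Section variational_problems.
Context {R : realType} {X H : normedModType R}.
Variables (A : {linear X -> H}) (J : X -> \bar R) (f : X).
Local Open Scope ereal_scope.

Definition Ftau (tau : R) (v : X) : \bar R :=
  (2^-1 * `|A (v - f)| ^+ 2)%:E + tau%:E * J v.

Definition Et (t : R) (u : X) : \bar R := `|A (u - f)|%:E + t%:E * J u.

End variational_problems.

Section standing_assumptions.
Context {R : realType} {X0 X H : normedModType R}.
Variables (ev : X -> X0 -> R) (A : {linear X -> H}) (J : X -> \bar R).

Definition norms_equivalent_on_null_set : Prop :=
  exists c C : R, [/\ 0 < c, 0 < C &
    forall u, null_set J u -> c * `|u| <= `|A u| /\ `|A u| <= C * `|u|].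

(* [w] is the H-orthogonal projection of [u] onto the null set of [J]. *)
Definition poincare_inequality : Prop :=
  exists2 C : R, 0 < C & forall u w : X,
    argmin (null_set J) (fun z => `|A (z - u)|%:E) w ->
    (`|u - w|%:E <= C%:E * J u)%E.

Definition weakstar_weak_continuity : Prop :=
  forall (w : nat -> X) (u : X),
    weakstar_cvg ev w u -> weak_cvg (fun n => A (w n)) (A u).

End standing_assumptions.

Section spectral_data.
Context {R : realType} {X H : normedModType R}.
Variables (A : {linear X -> H}) (n : nat).
(* Families are indexed from [1] to [n]; other indices are irrelevant. *)
Variables (gamma lambda : nat -> R) (u : nat -> X).

Definition pk (k : nat) : X :=
  \sum_(k <= i < n.+1) (Num.sg (gamma i) * lambda i) *: u i.

Definition tauk (k : nat) : R :=
  if k == 0%N then 0 else `|gamma k| / lambda k.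

(* [v] is the regularization path tau |-> v_tau. *)
Variables (f : X) (v : R -> X).

Definition residual (tau : R) : R := `|A (v tau - f)|.

Definition Tmap (tau : R) : R := tau / residual tau.

Definition tk (k : nat) : R := if k == 0%N then 0 else Tmap (tauk k).

(* The branch of S on the interval ]t_(k-1), t_k]. *)
Definition Sk (k : nat) (t : R) : R :=
  if k == 1%N then 0 else
  t * Num.sqrt (\sum_(1 <= i < k) gamma i ^+ 2 * `|A (u i)| ^+ 2)
    / Num.sqrt (1 - t ^+ 2 * `|A (pk k)| ^+ 2).

End spectral_data.

(* Main.v *)
Require Import Defs.
From mathcomp Require Import all_boot all_order all_algebra.
From mathcomp Require Import all_classical all_reals all_analysis.
From mathcomp Require Import ring lra.

Import Order.TTheory GRing.Theory Num.Theory.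
Import numFieldNormedType.Exports.

Local Open Scope classical_set_scope.
Local Open Scope ring_scope.

(** Both problems are solved by certificates. Write K for the subdifferential
    of J at 0. An element p of K with J e = <p, e> is a subgradient of J at e.
    If moreover f - e = tau p, then e is the unique minimizer of F_tau
    ([Ftau_argmin_unique]). For E_t the right normalization of p is t |p| <= 1:
    Cauchy-Schwarz then gives E_t w >= t <p, f> for every w, with equality
    exactly when J w = <p, w> and |f - w| = t <p, f - w>
    ([Et_dual_bound], [Et_dual_bound_eq]). Hence a point of the regularization
    path whose certificate p satisfies t |p| = 1 also minimizes E_t, and every
    other minimizer w shares the certificate p: equality in Cauchy-Schwarz
    forces w = f - sigma p for some sigma.

    The path is explicit. For tau between tau_(k-1) and tau_k,
      v_tau = sum over i >= k of (gamma_i - tau sgn(gamma_i) lambda_i) u_i,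
      (f - v_tau) / tau = sum over i < k of (gamma_i / tau) u_i + p_k.
    The second vector is in K because it is a convex combination of
    p_1, ..., p_k: passing from k to k+1 mixes its value at tau_k with p_(k+1)
    in the proportion tau_k / tau ([dual_pathS], [dual_path_in_K]). The first
    vector then satisfies J v = <p, v> by subadditivity of J, since each u_i
    is an eigenvector and no coefficient has changed sign before tau_i
    ([J_primal_path]).

    By orthogonality the certificate has squared norm
      (sum over i < k of gamma_i^2 |u_i|^2) / tau^2 + |p_k|^2,
    so for k > 1 the equation t |p| = 1 is solved by tau = S(t), and the bounds
    on t place S(t) in the right interval ([threshold_inversion]). For k = 1
    the certificate is p_1 for every tau up to tau_1, of norm 1 / t_1; when
    t <= t_1 it certifies f itself.

    For uniqueness when k > 1, a point f - sigma p certified by p must have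
    sigma = tau, since testing it against p_k and p_1, both in K, gives
    sigma <= tau and sigma >= tau ([dual_segment_unique]). For k = 1 and
    t < t_1 the bound t |p_1| < 1 leaves only w = f. *)

(** * Cauchy-Schwarz with its equality case *)

Section cauchy_schwarz.
Context {R : realType} {H : normedModType R} (ip : {dot H for idfun}).
Hypothesis H_hilbert : norm_induced_by ip.

Lemma ipC (x y : H) : ip x y = ip y x.
Proof. by rewrite hermC /= expr0 mul1r. Qed.

Lemma ipDl (x y z : H) : ip (x + y) z = ip x z + ip y z.
Proof. by rewrite linearDl. Qed.

Lemma ipNl (x z : H) : ip (- x) z = - ip x z.
Proof. by rewrite linearNl. Qed.

Lemma ipZl (c : R) (x z : H) : ip (c *: x) z = c * ip x z.
Proof. by rewrite linearZl_LR. Qed.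

Lemma ipDr (x y z : H) : ip x (y + z) = ip x y + ip x z.
Proof. by rewrite linearDr. Qed.

Lemma ipNr (x z : H) : ip x (- z) = - ip x z.
Proof. by rewrite linearNr. Qed.

Lemma ipZr (c : R) (x z : H) : ip x (c *: z) = c * ip x z.
Proof. by rewrite linearZr_LR. Qed.

Definition ipE := (ipDl, ipDr, ipNl, ipNr, ipZl, ipZr).

(** The defect in Cauchy-Schwarz is, up to a nonnegative factor, a squared
    norm; the inequality and its equality case both follow. *)
Lemma norm_scaled_diff (x y : H) :
  `| `|y| *: x - `|x| *: y| ^+ 2 = 2 * (`|x| * `|y|) * (`|x| * `|y| - ip x y).
Proof.
by rewrite H_hilbert !ipE (ipC y x) -!H_hilbert; ring.
Qed.

Lemma ip_le_norm (x y : H) : ip x y <= `|x| * `|y|.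
Proof.
have [->|x0] := eqVneq x 0; first by rewrite linear0l normr0 mul0r.
have [->|y0] := eqVneq y 0; first by rewrite linear0r normr0 mulr0.
have xy_gt0 : 0 < 2 * (`|x| * `|y|) by rewrite !mulr_gt0 ?normr_gt0.
by rewrite -subr_ge0 -(pmulr_rge0 _ xy_gt0) -norm_scaled_diff exprn_ge0.
Qed.

Lemma ip_eq_norm (x y : H) :
  ip x y = `|x| * `|y| -> `|y| *: x = `|x| *: y.
Proof.
move=> xyE; apply/eqP; rewrite -subr_eq0 -normr_eq0 -sqrf_eq0.
by rewrite norm_scaled_diff xyE subrr mulr0.
Qed.

End cauchy_schwarz.

(** * Convex homogeneous functionals *)

Section sublinear.
Context {R : realType} {X : normedModType R} (J : X -> \bar R).
Hypotheses (J_convex : convex_functional J) (J_homogeneous : abs_homogeneous J).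
Local Open Scope ereal_scope.

Lemma J_at0 : J 0%R = 0.
Proof. by rewrite -(scale0r 0%R) J_homogeneous normr0 mul0e. Qed.

(** x + y is the midpoint of 2x and 2y. *)
Lemma J_subadditive (x y : X) : J (x + y)%R <= J x + J y.
Proof.
have half z : (2^-1)%:E * J (2 *: z)%R = J z.
  by rewrite J_homogeneous muleA -EFinM ger0_norm// mulVf// mul1e.
have := J_convex (2 *: x)%R (2 *: y)%R 2^-1%R.
rewrite !scalerA (_ : 1 - 2^-1 = 2^-1)%R; last by field.
by rewrite !half mulVf// !scale1r; apply; lra.
Qed.

Lemma J_sum_le (I : Type) (r : seq I) (F : I -> X) (m : I -> R) (P : pred I) :
  (forall i, P i -> J (F i) <= (m i)%:E) ->
  J (\sum_(i <- r | P i) F i)%R <= (\sum_(i <- r | P i) m i)%R%:E.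
Proof.
move=> FP; elim/big_rec2: _ => [|i x y Pi xy]; first by rewrite J_at0.
by rewrite EFinD (le_trans (J_subadditive _ _))// leeD// FP.
Qed.

End sublinear.

(** * Dual certificates for the two variational problems *)

Section duality.
Context {R : realType} {X H : normedModType R} (ip : {dot H for idfun}).
Context (A : {linear X -> H}) (J : X -> \bar R).
Hypotheses (H_hilbert : norm_induced_by ip) (A_injective : injective A).

Local Notation bracket x y := (ip (A x) (A y)).

Lemma image_distC (x y : X) : `|A (x - y)| = `|A (y - x)|.
Proof. by rewrite !(linearB A) distrC. Qed.

(** The part of the subdifferential of J at 0 that is represented, through the
    Riesz embedding, by elements of X. *)
Definition in_K (p : X) : Prop := forall w, ((bracket p w)%:E <= J w)%E.

Lemma in_K_convex (p q : X) (s : R) : 0 <= s <= 1 ->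
  in_K p -> in_K q -> in_K (s *: p + (1 - s) *: q).
Proof.
move=> s01 pK qK w; move: (pK w) (qK w).
case: (J w) => [j||]; rewrite ?lee_fin ?leey//.
rewrite !(linearD A, linearZ_LR A) !ipE => pj qj.
by nra.
Qed.

Lemma subdiff0_in_K (p : X) : J 0 = 0%E ->
  subdiff J 0 (riesz ip A (A p)) -> in_K p.
Proof.
by move=> J0 [_ pJ] w; have := pJ w; rewrite J0 add0e subr0.
Qed.

(** As p is in K, F_tau w is at least |w - f|^2 / 2 + tau <p, w>, and this
    quadratic function of w equals F_tau e + |w - e|^2 / 2. *)
Lemma Ftau_argmin_unique (f e p w : X) (tau : R) : 0 < tau ->
  in_K p -> J e = (bracket p e)%:E -> f - e = tau *: p ->
  argmin [set: X] (Ftau A J f tau) w -> w = e.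
Proof.
move=> tau0 pK Je fe [_ /(_ e I)].
have eE : e = f - tau *: p by rewrite -fe subKr.
rewrite /Ftau Je; move: (pK w); case: (J w) => [j||].
- rewrite !lee_fin /= => pj Fwe.
  apply: A_injective; apply/eqP; rewrite -subr_eq0 -normr_eq0.
  rewrite -sqrf_eq0 eq_le exprn_ge0// andbT; move: Fwe pj.
  rewrite !H_hilbert eE !(linearD A, linearN A, linearZ_LR A) !ipE.
  rewrite (ipC ip (A w) (A p)) (ipC ip (A f) (A p)) (ipC ip (A f) (A w)).
  by nra.
- by rewrite gt0_muley ?lte_fin//= ?addey// leye_eq.
- by rewrite leeNy_eq.
Qed.

(** |f - w| >= t |p| |f - w| >= t <p, f - w> and J w >= <p, w>. *)
Lemma Et_dual_bound (f p w : X) (t : R) : 0 <= t -> t * `|A p| <= 1 ->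
  in_K p -> ((t * bracket p f)%:E <= Et A J f t w)%E.
Proof.
move=> t0 tp pK; rewrite /Et; have := pK w; case: (J w) => [j||].
- rewrite -EFinM -EFinD !lee_fin => pj.
  have := ip_le_norm ip H_hilbert (A p) (A (f - w)).
  rewrite image_distC (linearB A f w) !ipE => pfw.
  have := normr_ge0 (A (w - f)).
  by nra.
- by move: t0; rewrite le_eqVlt => /predU1P[<-|t0 _]; 
    rewrite ?mul0e ?mul0r ?adde0 ?lee_fin// gt0_muley// addey// leey.
- by rewrite leeNy_eq.
Qed.

(** Attaining the bound makes both inequalities behind it equalities; t > 0 is
    what transfers this to the one for J. *)
Lemma Et_dual_bound_eq (f p w : X) (t : R) : 0 < t -> t * `|A p| <= 1 ->
  in_K p -> (Et A J f t w <= (t * bracket p f)%:E)%E ->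
  J w = (bracket p w)%:E /\ `|A (f - w)| = t * bracket p (f - w).
Proof.
move=> t0 tp pK; rewrite /Et; have := pK w; case: (J w) => [j||].
- rewrite -EFinM -EFinD !lee_fin => pj.
  have := ip_le_norm ip H_hilbert (A p) (A (f - w)).
  rewrite (image_distC w f) => pfw Ew.
  have pfE : bracket p (f - w) = bracket p f - bracket p w.
    by rewrite (linearB A) !ipE.
  have N0 := normr_ge0 (A (f - w)).
  have tpfw : t * bracket p (f - w) <= `|A (f - w)| by nra.
  have jE : j = bracket p w by apply/eqP; rewrite eq_le pj andbT; nra.
  by split; [rewrite jE | apply/eqP; rewrite eq_le tpfw andbT; nra].
- by rewrite gt0_muley ?lte_fin//= ?addey// leye_eq.
- by rewrite leeNy_eq.
Qed.

Lemma Et_argmin (f p e : X) (t : R) : 0 <= t -> t * `|A p| <= 1 ->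
  in_K p -> J e = (bracket p e)%:E -> `|A (f - e)| = t * bracket p (f - e) ->
  argmin [set: X] (Et A J f t) e.
Proof.
move=> t0 tp pK Je fe; split=> // w _.
apply: le_trans (Et_dual_bound _ _ _ _ t0 tp pK).
rewrite /Et Je -EFinM -EFinD lee_fin (image_distC e) fe.
by rewrite (linearB A) !ipE; lra.
Qed.

(** A certificate of one minimizer certifies all of them. *)
Lemma Et_argmin_dual (f p e w : X) (t : R) : 0 < t -> t * `|A p| <= 1 ->
  in_K p -> J e = (bracket p e)%:E -> `|A (f - e)| = t * bracket p (f - e) ->
  argmin [set: X] (Et A J f t) w ->
  J w = (bracket p w)%:E /\ `|A (f - w)| = t * bracket p (f - w).
Proof.
move=> t0 tp pK Je fe [_ /(_ e I) Ewe]; apply: Et_dual_bound_eq => //.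
rewrite (le_trans Ewe)// /Et Je -EFinM -EFinD lee_fin.
by rewrite (image_distC e) fe (linearB A) !ipE; lra.
Qed.

End duality.

(** * Inverting the reparametrization *)

(** The function G / s^2 + P decreases in s, so comparing its values at a and
    at b with 1 / t^2 locates the root s of s^2 (1 - t^2 P) = t^2 G. The
    comparison at b also makes 1 - t^2 P positive. *)
Lemma threshold_inversion {R : realType} (a b t G P : R) :
  0 < a -> 0 < b -> 0 < t -> 0 < G ->
  1 < t ^+ 2 * (G / a ^+ 2 + P) -> t ^+ 2 * (G / b ^+ 2 + P) <= 1 ->
  let s := t * Num.sqrt G / Num.sqrt (1 - t ^+ 2 * P) in
  [/\ a < s, s <= b & t ^+ 2 * (G / s ^+ 2 + P) = 1].
Proof.
move=> a0 b0 t0 G0 ta tb s.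
have a2 : 0 < a ^+ 2 by rewrite exprn_gt0.
have b2 : 0 < b ^+ 2 by rewrite exprn_gt0.
have tG : 0 < t ^+ 2 * G by rewrite mulr_gt0 ?exprn_gt0.
set D := 1 - t ^+ 2 * P.
have Da : D * a ^+ 2 < t ^+ 2 * G.
  by rewrite -ltr_pdivlMr// /D; move: ta; rewrite mulrDr mulrA; lra.
have Db : t ^+ 2 * G <= D * b ^+ 2.
  by rewrite -ler_pdivrMr// /D; move: tb; rewrite mulrDr mulrA; lra.
have D0 : 0 < D by rewrite -(pmulr_lgt0 _ b2) (lt_le_trans tG).
have s0 : 0 < s by rewrite divr_gt0 ?mulr_gt0 ?sqrtr_gt0.
have s2 : s ^+ 2 = t ^+ 2 * G / D.
  by rewrite /s exprMn exprVn exprMn !sqr_sqrtr ?ltW.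
have nneg x : 0 < x -> x \is Num.nneg by move=> /ltW.
split.
- by rewrite -(ltr_pXn2r (n := 2)) ?nneg// s2 ltr_pdivlMr// mulrC.
- by rewrite -(ler_pXn2r (n := 2)) ?nneg// s2 ler_pdivrMr// (mulrC (b ^+ 2)).
- rewrite s2 [RHS](_ : 1 = D + t ^+ 2 * P); last by rewrite /D subrK.
  by field; rewrite !gt_eqF.
Qed.

(** * The regularization path of a sum of eigenvectors *)

Section spectral.
Context {R : realType} {X H : normedModType R} (ip : {dot H for idfun}).
Context (A : {linear X -> H}) (J : X -> \bar R).
Context (n : nat) (gamma lambda : nat -> R) (u : nat -> X) (f : X).
Hypotheses (H_hilbert : norm_induced_by ip) (A_injective : injective A).
Hypotheses (J_convex : convex_functional J) (J_homogeneous : abs_homogeneous J).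
Hypothesis f_def : f = \sum_(1 <= i < n.+1) gamma i *: u i.
Hypothesis gamma_neq0 : forall i, (1 <= i <= n)%N -> gamma i != 0.
Hypothesis lambda_gt0 : forall i, (1 <= i <= n)%N -> 0 < lambda i.
Hypothesis u_neq0 : forall i, (1 <= i <= n)%N -> u i != 0.
Hypothesis u_eigen : forall i, (1 <= i <= n)%N ->
  subdiff J (u i) (riesz ip A (A (lambda i *: u i))).
Hypothesis u_orthogonal : forall i j, (1 <= i <= n)%N -> (1 <= j <= n)%N ->
  i != j -> ip (A (u i)) (A (u j)) = 0.
Hypothesis pk_in_K : forall k, (1 <= k <= n)%N ->
  subdiff J 0 (riesz ip A (A (pk n gamma lambda u k))).
Hypothesis ratio_increasing : forall i, (1 <= i < n)%N ->
  `|gamma i| / lambda i < `|gamma i.+1| / lambda i.+1.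

Local Notation bracket x y := (ip (A x) (A y)).
Local Notation tau_ k := (tauk gamma lambda k).
Local Notation comb c := (\sum_(1 <= i < n.+1) c i *: u i).
Local Notation pk_ k := (pk n gamma lambda u k).

(** The coefficients of (f - v_tau) / tau for tau between tau_(k-1) and tau_k. *)
Definition dual_coef (k : nat) (tau : R) (i : nat) : R :=
  if (i < k)%N then gamma i / tau else Num.sg (gamma i) * lambda i.

Definition dual_path (k : nat) (tau : R) : X := comb (dual_coef k tau).

(** The coefficients of v_tau for tau between tau_(k-1) and tau_k: the
    components before k have been shrunk to 0. *)
Definition primal_coef (k : nat) (tau : R) (i : nat) : R :=
  if (i < k)%N then 0 else gamma i - tau * (Num.sg (gamma i) * lambda i).

Definition primal_path (k : nat) (tau : R) : X := comb (primal_coef k tau).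

Lemma bracket_comb (c d : nat -> R) :
  bracket (comb c) (comb d) =
  \sum_(1 <= i < n.+1) c i * d i * `|A (u i)| ^+ 2.
Proof.
rewrite !(linear_sum A) linear_sumlz; apply: eq_big_nat => i i1n.
rewrite linear_sumr (bigD1_seq i) ?iota_uniq ?mem_index_iota//=.
rewrite big_nat_cond big1 => [|j /andP[j1n ji]].
  by rewrite addr0 !(linearZ_LR A) !ipE -H_hilbert mulrA.
by rewrite !(linearZ_LR A) !ipE u_orthogonal ?mulr0// eq_sym.
Qed.

Lemma u_norm_gt0 (i : nat) : (1 <= i <= n)%N -> 0 < `|A (u i)| ^+ 2.
Proof.
move=> i1n; rewrite exprn_gt0// normr_gt0 -(linear0 A).
by apply: contra_neq (u_neq0 i i1n) => /A_injective.
Qed.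

(** Testing the subgradient inequality at the point 0 gives the bound; in
    particular J (u i) is finite. *)
Lemma J_eigenvector (i : nat) : (1 <= i <= n)%N ->
  (J (u i) <= (lambda i * `|A (u i)| ^+ 2)%:E)%E.
Proof.
move=> /u_eigen[_ /(_ 0)]; rewrite (J_at0 J J_homogeneous) /riesz.
rewrite sub0r (linearN A) (linearZ_LR A) !ipE -H_hilbert.
by case: (J (u i)) => [j||]; rewrite ?leNye// -EFinD !lee_fin; lra.
Qed.

Lemma tau_gt0 (k : nat) : (1 <= k <= n)%N -> 0 < tau_ k.
Proof.
move=> k1n; rewrite /tauk; case: eqP => [k0|_]; first by rewrite k0 in k1n.
by rewrite divr_gt0 ?lambda_gt0// normr_gt0 gamma_neq0.
Qed.

Lemma tau_ge0 (k : nat) : (k <= n)%N -> 0 <= tau_ k.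
Proof.
case: k => [_|k kn]; first by rewrite /tauk eqxx.
by rewrite ltW// tau_gt0.
Qed.

Lemma tau_ltS (k : nat) : (k < n)%N -> tau_ k < tau_ k.+1.
Proof.
case: k => [n0|k kn]; first by rewrite {1}/tauk eqxx tau_gt0.
by rewrite /tauk /= ratio_increasing.
Qed.

Lemma tau_le (i k : nat) : (i <= k <= n)%N -> tau_ i <= tau_ k.
Proof.
elim: k => [|k IHk] /andP[]; first by rewrite leqn0 => /eqP ->.
rewrite leq_eqVlt ltnS => /predU1P[->//|ik kn].
by apply: le_trans (IHk _) (ltW (tau_ltS k kn)); rewrite ik ltnW.
Qed.

Lemma tau_mul_lambda (i : nat) : (1 <= i <= n)%N ->
  tau_ i * lambda i = `|gamma i|.
Proof.
move=> i1n; rewrite /tauk; case: eqP => [i0|_]; first by rewrite i0 in i1n.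
by rewrite divfK// gt_eqF// lambda_gt0.
Qed.

Lemma pk_comb (k : nat) : (1 <= k <= n)%N ->
  pk_ k = comb (fun i => if (i < k)%N then 0 else Num.sg (gamma i) * lambda i).
Proof.
move=> /andP[k1 kn]; rewrite [RHS](big_cat_nat k1)/=; last exact: ltnW.
rewrite [X in X + _]big_nat_cond [X in X + _]big1 ?add0r.
  by apply: eq_big_nat => i /andP[ki _]; rewrite ltnNge ki.
by move=> i /andP[/andP[_ ->]]; rewrite scale0r.
Qed.

Lemma dual_path1 (tau : R) : dual_path 1 tau = pk_ 1.
Proof. by apply: eq_big_nat => i /andP[i1 _]; rewrite /dual_coef ltnNge i1. Qed.

(** The coefficient of u_k is the one to check: sgn(gamma_k) lambda_k tau_k / tau
    equals gamma_k / tau because tau_k lambda_k = |gamma_k|. *)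
Lemma dual_pathS (k : nat) (tau : R) : (1 <= k < n)%N -> 0 < tau ->
  dual_path k.+1 tau =
  (tau_ k / tau) *: dual_path k (tau_ k) + (1 - tau_ k / tau) *: pk_ k.+1.
Proof.
move=> /andP[k1 kn] tau0; have k1n : (1 <= k <= n)%N by rewrite k1 ltnW.
rewrite pk_comb// !scaler_sumr -big_split/=; apply: eq_big_nat => i i1n.
rewrite !scalerA -scalerDl /dual_coef ltnS; congr (_ *: _).
case: ltngtP => [ik|ki|->].
- have taui : tau_ k != 0 by rewrite gt_eqF// tau_gt0.
  by field; rewrite taui gt_eqF.
- by ring.
- rewrite mulr0 addr0 -{1}(mulr_sg_norm (gamma k)) -tau_mul_lambda//.
  by field; rewrite gt_eqF.
Qed.

(** By induction on k: [dual_pathS] writes the certificate as a combination of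
    its value at tau_(k-1), in K by induction, and of p_k; the bound
    tau >= tau_(k-1) makes the combination convex. *)
Lemma dual_path_in_K (k : nat) (tau : R) : (1 <= k <= n)%N ->
  tau_ k.-1 <= tau -> in_K ip A J (dual_path k tau).
Proof.
have pK j : (1 <= j <= n)%N -> in_K ip A J (pk_ j).
  by move=> /pk_in_K; apply: subdiff0_in_K; exact: J_at0.
elim: k tau => [//|[_|k IHk]] tau kn tau_ge.
  by rewrite dual_path1; apply: pK.
have k1n : (1 <= k.+1 <= n)%N by rewrite (ltnW kn).
have tau0 : 0 < tau by rewrite (lt_le_trans _ tau_ge)// tau_gt0.
rewrite dual_pathS//; apply: in_K_convex; [|apply: IHk|exact: pK] => //.
- by rewrite ler_pdivrMr// mul1r tau_ge andbT divr_ge0 ?tau_ge0 ?ltW// ltnW.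
- by apply: tau_le; rewrite leqnSn ltnW.
Qed.

(** Past the first interval tau is positive, so that the coefficients
    gamma_i / tau are genuine quotients; for k = 1 they do not occur and tau = 0
    is allowed. *)
Lemma tau_pred_gt0 (k i : nat) (tau : R) : (1 <= k <= n)%N ->
  tau_ k.-1 <= tau -> (1 <= i < k)%N -> 0 < tau.
Proof.
move=> /andP[k1 kn] tau_ge /andP[i1 ik].
have k2 : (0 < k.-1)%N by rewrite ltn_predRL (leq_ltn_trans i1).
by rewrite (lt_le_trans _ tau_ge)// tau_gt0// k2 (leq_trans (leq_pred _)).
Qed.

Lemma residual_path (k : nat) (tau : R) : (1 <= k <= n)%N ->
  tau_ k.-1 <= tau -> f - primal_path k tau = tau *: dual_path k tau.
Proof.
move=> k1n tau_ge; rewrite f_def scaler_sumr -sumrB; apply: eq_big_nat => i i1n.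
rewrite scalerA -scalerBl /primal_coef /dual_coef; congr (_ *: _).
case: ifP => [ik|_]; last by ring.
rewrite subr0 mulrC divfK// gt_eqF// (tau_pred_gt0 k i)// ik.
by case/andP: i1n => ->.
Qed.

(** Only the upper bound needs work, K giving the other. Subadditivity bounds J
    by the sum of |c_i| lambda_i |u_i|^2 over i >= k with
    c_i = gamma_i - tau sgn(gamma_i) lambda_i. As tau <= tau_k <= tau_i, the
    sign of c_i is still that of gamma_i, and the sum is the bracket. *)
Lemma J_primal_path (k : nat) (tau : R) : (1 <= k <= n)%N ->
  tau_ k.-1 <= tau <= tau_ k ->
  J (primal_path k tau) = (bracket (dual_path k tau) (primal_path k tau))%:E.
Proof.
move=> k1n /andP[tau_ge tau_le_k]; apply/eqP.
rewrite eq_le dual_path_in_K// andbT bracket_comb.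
rewrite /primal_path big_nat_cond [X in (_ <= X%:E)%E]big_nat_cond.
apply: J_sum_le => // i /andP[i1n _].
rewrite J_homogeneous.
apply: le_trans (lee_wpmul2l _ (J_eigenvector i i1n)) _; first by rewrite lee_fin.
rewrite -EFinM lee_fin mulrA ler_wpM2r ?exprn_ge0//.
rewrite /primal_coef /dual_coef; case: ltnP => [_|ki].
  by rewrite normr0 mul0r mulr0.
have l0 := lambda_gt0 i i1n.
have g0 : tau * lambda i <= `|gamma i|.
  rewrite -tau_mul_lambda// ler_pM2r// (le_trans tau_le_k)//.
  by apply: tau_le; rewrite ki; case/andP: i1n.
have {1 2}-> : gamma i - tau * (Num.sg (gamma i) * lambda i) =
    Num.sg (gamma i) * (`|gamma i| - tau * lambda i).
  by rewrite {1}(numEsg (gamma i)); ring.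
rewrite normrM normr_sg gamma_neq0// mul1r ger0_norm ?subr_ge0//.
by rewrite mulrACA -expr2 sqr_sg gamma_neq0// mul1r mulrC.
Qed.

Context (v : R -> X).
Hypothesis v_at0 : v 0 = f.
Hypothesis v_min :
  forall tau, 0 < tau -> argmin [set: X] (Ftau A J f tau) (v tau).

(** At tau = 0, which only k = 1 reaches, the formula gives f, the prescribed
    value. *)
Lemma regularization_path (k : nat) (tau : R) :
  (1 <= k <= n)%N -> tau_ k.-1 <= tau <= tau_ k ->
  v tau = primal_path k tau.
Proof.
move=> k1n /[dup] tau_in /andP[tau_ge _].
have k0n : (k.-1 <= n)%N by case/andP: k1n => _; apply/leq_trans/leq_pred.
have := le_trans (tau_ge0 _ k0n) tau_ge.
rewrite le_eqVlt => /predU1P[tau0|tau0].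
  rewrite -tau0 v_at0 -[LHS](subrK (primal_path k 0)) tau0 residual_path//.
  by rewrite -{1}tau0 scale0r add0r.
apply: (Ftau_argmin_unique ip A J H_hilbert A_injective f _ _ _ tau tau0).
- exact: dual_path_in_K k1n tau_ge.
- exact: J_primal_path.
- exact: residual_path.
- exact: v_min.
Qed.

Lemma norm_dual_path (k : nat) (tau : R) : (1 <= k <= n)%N ->
  `|A (dual_path k tau)| ^+ 2 =
  (\sum_(1 <= i < k) gamma i ^+ 2 * `|A (u i)| ^+ 2) / tau ^+ 2 +
  `|A (pk_ k)| ^+ 2.
Proof.
move=> /[dup] k1n /andP[k1 kn].
rewrite pk_comb// !H_hilbert !bracket_comb (big_cat_nat k1 (leqW kn))/=.
rewrite [X in _ = _ + X](big_cat_nat k1 (leqW kn))/=.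
rewrite [X in _ = _ + (X + _)]big_nat_cond [X in _ = _ + (X + _)]big1; last first.
  by move=> i /andP[/andP[_ ->]]; rewrite !mul0r.
rewrite add0r; congr (_ + _).
  rewrite mulr_suml; apply: eq_big_nat => i /andP[_ ik].
  by rewrite /dual_coef ik -exprVn; ring.
by apply: eq_big_nat => i /andP[ki _]; rewrite /dual_coef ltnNge ki.
Qed.

Lemma coef_le_norm_comb (c : nat -> R) (j : nat) : (1 <= j <= n)%N ->
  c j ^+ 2 * `|A (u j)| ^+ 2 <= `|A (comb c)| ^+ 2.
Proof.
move=> j1n; rewrite [leRHS]H_hilbert bracket_comb.
rewrite (bigD1_seq j) ?iota_uniq ?mem_index_iota//= -expr2 lerDl.
by apply: sumr_ge0 => i _; rewrite -expr2 mulr_ge0// sqr_ge0.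
Qed.

Lemma norm_dual_path_gt0 (k : nat) (tau : R) : (1 <= k <= n)%N ->
  0 < `|A (dual_path k tau)|.
Proof.
move=> k1n; rewrite lt_neqAle normr_ge0 andbT eq_sym -sqrf_eq0 gt_eqF//.
apply: lt_le_trans (coef_le_norm_comb (dual_coef k tau) k k1n).
rewrite mulr_gt0 ?u_norm_gt0// /dual_coef ltnn.
by rewrite exprMn sqr_sg gamma_neq0// mul1r exprn_gt0// lambda_gt0.
Qed.

(** At a breakpoint the formulas of the two adjacent intervals agree. *)
Lemma dual_path_switch (k : nat) : (1 <= k < n)%N ->
  dual_path k.+1 (tau_ k) = dual_path k (tau_ k).
Proof.
move=> k1n; have tau0 : 0 < tau_ k.
  by apply: tau_gt0; case/andP: k1n => -> /ltnW.
by rewrite dual_pathS// divff ?gt_eqF// scale1r subrr scale0r addr0.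
Qed.

(** The residual at tau_k is tau_k times the norm of the certificate. *)
Lemma tk_dual_path (k : nat) : (1 <= k <= n)%N ->
  tk A gamma lambda f v k = `|A (dual_path k (tau_ k))|^-1.
Proof.
move=> k1n; have tau0 := tau_gt0 k k1n.
have tau_pred : tau_ k.-1 <= tau_ k.
  by apply: tau_le; rewrite leq_pred; case/andP: k1n.
rewrite /tk /Tmap /residual.
rewrite (regularization_path k)//; last by rewrite tau_pred/=.
rewrite image_distC residual_path// (linearZ_LR A) normrZ gtr0_norm//.
rewrite gtn_eqF; last by case/andP: k1n.
by have N0 := norm_dual_path_gt0 k (tau_ k) k1n; field; rewrite !gt_eqF.
Qed.

(** On the line f - sigma p, the brackets with p_k - p and p_1 - p are both
    multiples of s - sigma, by sums over i < k of opposite signs: the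
    coefficients of p_k vanish there, while those of p_1 exceed those of p in
    absolute value because s > tau_(k-1) >= tau_i. Neither bracket may be
    positive at a point where p attains J, so sigma = s. *)
Lemma dual_segment_unique (k : nat) (s sigma : R) (w : X) :
  (1 < k <= n)%N -> tau_ k.-1 < s ->
  J w = (bracket (dual_path k s) w)%:E ->
  w = f - sigma *: dual_path k s -> sigma = s.
Proof.
move=> /[dup] k2n /andP[k1 kn] s_gt Jw wE.
have k1n : (1 <= k <= n)%N by rewrite ltnW.
have n1 : (1 <= 1 <= n)%N by rewrite (leq_trans (ltnW k1) kn).
have s0 : 0 < s by rewrite (le_lt_trans _ s_gt)// tau_ge0// (leq_trans (leq_pred _)).
have gap q : in_K ip A J q -> bracket q w <= bracket (dual_path k s) w.
  by move=> /(_ w); rewrite Jw lee_fin.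
have w_comb : w = comb (fun i => gamma i - sigma * dual_coef k s i).
  rewrite wE f_def scaler_sumr -sumrB; apply: eq_bigr => i _.
  by rewrite scalerA scalerBl.
(* Elements of K with the coefficients of p from k on: these coefficients
   cancel in the difference with p. *)
have gap_comb c q : (forall i, (k <= i <= n)%N ->
      c i = Num.sg (gamma i) * lambda i) -> q = comb c -> in_K ip A J q ->
    (s - sigma) * (\sum_(1 <= i < k)
       (c i * gamma i - gamma i ^+ 2 / s) * `|A (u i)| ^+ 2) <= 0.
  move=> ck -> /gap.
  rewrite -subr_le0 -(pmulr_rle0 _ s0); congr (_ <= _).
  rewrite w_comb !bracket_comb -sumrB mulr_sumr.
  rewrite (big_cat_nat (ltnW k1) (leqW kn))/=.
  rewrite [X in _ + X]big_nat_cond [X in _ + X]big1 ?addr0; last first.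
    move=> i /andP[ki _]; rewrite ck// /dual_coef ltnNge.
    by case/andP: ki => -> _; rewrite /= subrr mulr0.
  rewrite mulr_sumr; apply: eq_big_nat => i /andP[_ ik].
  by rewrite /dual_coef ik; field; rewrite gt_eqF.
have sum_gt0 c : (forall i, (1 <= i < k)%N -> 0 < c i) ->
    0 < \sum_(1 <= i < k) c i * `|A (u i)| ^+ 2.
  move=> c0; rewrite (big_ltn k1) ltr_pwDl//.
    by rewrite mulr_gt0 ?c0 ?u_norm_gt0.
  rewrite big_nat_cond sumr_ge0// => i /andP[/andP[i1 ik] _].
  by rewrite mulr_ge0 ?exprn_ge0// ltW// c0// ltnW.
have gamma2_gt0 i : (1 <= i < k)%N -> 0 < gamma i ^+ 2.
  move=> /andP[i1 ik]; rewrite exprn_even_gt0//= gamma_neq0// i1.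
  by rewrite (leq_trans (ltnW ik)).
have pkK j : (1 <= j <= n)%N -> in_K ip A J (pk_ j).
  by move=> /pk_in_K; apply: subdiff0_in_K; exact: J_at0.
apply/eqP; rewrite eq_le; apply/andP; split.
(* p_k gives sigma <= s, and p_1 gives s <= sigma. *)
- have := gap_comb _ _ _ (pk_comb k k1n) (pkK k k1n).
  rewrite -oppr_ge0 -mulrN -sumrN.
  rewrite (eq_big_nat _ _ (F2 := fun i => gamma i ^+ 2 / s * `|A (u i)| ^+ 2)).
    rewrite pmulr_lge0 ?subr_ge0; first by apply => i /andP[]; case: ltnP.
    by apply: (sum_gt0 (fun i => gamma i ^+ 2 / s)) => i /gamma2_gt0 ?; rewrite divr_gt0.
  by move=> i /andP[_ ->]; rewrite mul0r sub0r mulNr opprK.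
- have := gap_comb _ _ _ (pk_comb 1 n1) (pkK 1 n1).
  rewrite pmulr_lle0 ?subr_le0.
    by apply => i /andP[ki _]; rewrite ltnNge (leq_trans (ltnW k1)).
  apply: (sum_gt0 (fun i => _ * gamma i - gamma i ^+ 2 / s)) => i /[dup] i1k /andP[i1 ik].
  have i1n : (1 <= i <= n)%N by rewrite i1 (leq_trans (ltnW ik)).
  have tau_i : tau_ i < s.
    apply: le_lt_trans s_gt; apply: tau_le.
    by rewrite -ltnS prednK ?(leq_trans (leq_pred _)) ?ik// ltnW.
  have g0 : 0 < `|gamma i| by rewrite normr_gt0 gamma_neq0.
  rewrite ltnNge i1 /= subr_gt0 ltr_pdivrMr// (mulrAC (Num.sg _)) -normrEsg.
  rewrite -real_normK ?num_real// expr2 -mulrA ltr_pM2l//.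
  by rewrite -tau_mul_lambda// mulrC ltr_pM2l// lambda_gt0.
Qed.

Lemma residual_v (k : nat) (tau : R) : (1 <= k <= n)%N ->
  tau_ k.-1 <= tau <= tau_ k -> f - v tau = tau *: dual_path k tau.
Proof.
move=> k1n /[dup] tau_in /andP[tau_ge _].
by rewrite (regularization_path k)// residual_path.
Qed.

Lemma J_v (k : nat) (tau : R) : (1 <= k <= n)%N ->
  tau_ k.-1 <= tau <= tau_ k ->
  J (v tau) = (bracket (dual_path k tau) (v tau))%:E.
Proof.
by move=> k1n tau_in; rewrite (regularization_path k)// J_primal_path.
Qed.

(** p_1 certifies f, and t_1 = 1 / |p_1|. Strictly below t_1 the equality
    |f - w| = t <p_1, f - w> <= t |p_1| |f - w| is only possible for w = f. *)
Lemma Et_first_interval (t : R) : (1 <= n)%N ->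
  0 < t <= tk A gamma lambda f v 1 ->
  argmin [set: X] (Et A J f t) f /\
  (t != tk A gamma lambda f v 1 ->
     forall w, argmin [set: X] (Et A J f t) w -> w = f).
Proof.
move=> n1 /andP[t0 t_le]; have n11 : (1 <= 1 <= n)%N by [].
have tau01 : tau_ 0 <= 0 <= tau_ 1.
  by rewrite {1}/tauk eqxx lexx tau_ge0.
have pK := dual_path_in_K 1 0 n11 (proj1 (andP tau01)).
have Jf := J_v 1 0 n11 tau01; rewrite v_at0 in Jf.
have t1E : tk A gamma lambda f v 1 = `|A (dual_path 1 0)|^-1.
  by rewrite tk_dual_path// !dual_path1.
have p0 := norm_dual_path_gt0 1 0 n11.
set p := dual_path 1 0 in pK Jf t1E p0.
have tp : t * `|A p| <= 1 by rewrite -ler_pdivlMr// div1r -t1E.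
have fE : `|A (f - f)| = t * bracket p (f - f).
  by rewrite subrr linear0 linear0r normr0 mulr0.
split; first exact: (Et_argmin ip A J H_hilbert f p f t (ltW t0) tp).
move=> t_neq w w_min.
have [_ fw] := Et_argmin_dual ip A J H_hilbert f p f w t t0 tp pK Jf fE w_min.
have tp1 : t * `|A p| < 1.
  by rewrite -ltr_pdivlMr// div1r -t1E lt_neqAle t_neq.
apply/esym/A_injective/eqP; rewrite -subr_eq0 -(linearB A) -normr_le0.
have := ip_le_norm ip H_hilbert (A p) (A (f - w)).
have := normr_ge0 (A (f - w)).
by nra.
Qed.

Lemma sum_gamma_gt0 (k : nat) : (1 < k <= n)%N ->
  0 < \sum_(1 <= i < k) gamma i ^+ 2 * `|A (u i)| ^+ 2.
Proof.
move=> /andP[k1 kn]; have n1 := leq_trans (ltnW k1) kn.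
rewrite (big_ltn k1) ltr_pwDl//.
  by rewrite mulr_gt0 ?u_norm_gt0// exprn_even_gt0//= gamma_neq0.
by apply: sumr_ge0 => i _; rewrite mulr_ge0 ?sqr_ge0.
Qed.

Lemma Sk_inverse (k : nat) (t : R) : (1 < k <= n)%N ->
  tk A gamma lambda f v k.-1 < t <= tk A gamma lambda f v k ->
  let s := Sk A n gamma lambda u k t in
  [/\ 0 < t, tau_ k.-1 < s, s <= tau_ k & t * `|A (dual_path k s)| = 1].
Proof.
move=> /[dup] k2n /andP[k1 kn] /andP[t_gt t_le] s.
have k1n : (1 <= k <= n)%N by rewrite ltnW.
have pred1 : (1 <= k.-1 < n)%N.
  by rewrite ltn_predRL k1 (leq_trans _ kn)// ltn_predL ltnW.
have kS : k.-1.+1 = k by apply: prednK; rewrite ltnW.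
have pred1n : (1 <= k.-1 <= n)%N by case/andP: pred1 => -> /ltnW.
set G := \sum_(1 <= i < k) gamma i ^+ 2 * `|A (u i)| ^+ 2.
have t0 : 0 < t.
  by apply: lt_trans t_gt; rewrite tk_dual_path// invr_gt0 norm_dual_path_gt0.
(* The certificate at tau_(k-1) is read off the k-th formula. *)
have ta : 1 < t ^+ 2 * (G / tau_ k.-1 ^+ 2 + `|A (pk_ k)| ^+ 2).
  rewrite -norm_dual_path// -{1}kS dual_path_switch// -exprMn expr_gt1//.
    by rewrite -ltr_pdivrMr ?norm_dual_path_gt0// div1r -tk_dual_path.
  by rewrite mulr_ge0// ltW.
have tb : t ^+ 2 * (G / tau_ k ^+ 2 + `|A (pk_ k)| ^+ 2) <= 1.
  rewrite -norm_dual_path// -exprMn expr_le1 ?mulr_ge0 ?(ltW t0)//.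
  by rewrite -ler_pdivlMr ?norm_dual_path_gt0// div1r -tk_dual_path.
have sE : s = t * Num.sqrt G / Num.sqrt (1 - t ^+ 2 * `|A (pk_ k)| ^+ 2).
  by rewrite /s /Sk gtn_eqF.
have [] := threshold_inversion _ _ _ _ _ (tau_gt0 _ pred1n) (tau_gt0 _ k1n)
  t0 (sum_gamma_gt0 k k2n) ta tb.
rewrite -sE => s_gt s_le sP; split=> //.
apply/eqP; rewrite -(@pexpr_eq1 _ _ 2)// ?mulr_ge0 ?(ltW t0)//.
by rewrite exprMn norm_dual_path// sP.
Qed.

Lemma Et_later_interval (k : nat) (t s : R) : (1 < k <= n)%N -> 0 < t ->
  tau_ k.-1 < s -> s <= tau_ k -> t * `|A (dual_path k s)| = 1 ->
  argmin [set: X] (Et A J f t) (v s) /\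
  (forall w, argmin [set: X] (Et A J f t) w -> w = v s).
Proof.
move=> /[dup] k2n /andP[k1 kn] t0 s_gt s_le tp.
have k1n : (1 <= k <= n)%N by rewrite ltnW.
have s0 : 0 < s.
  by apply: le_lt_trans s_gt; rewrite tau_ge0// (leq_trans (leq_pred _)).
have s_in : tau_ k.-1 <= s <= tau_ k by rewrite ltW.
have pK := dual_path_in_K k s k1n (ltW s_gt).
have Je := J_v k s k1n s_in.
have fe := residual_v k s k1n s_in.
have p0 := norm_dual_path_gt0 k s k1n.
have tp_le : t * `|A (dual_path k s)| <= 1 by rewrite tp.
have fE : `|A (f - v s)| = t * bracket (dual_path k s) (f - v s).
  rewrite fe (linearZ_LR A) ipZr normrZ gtr0_norm// -H_hilbert.
  by rewrite expr2 mulrCA (mulrA t) tp mul1r.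
split; first exact: (Et_argmin ip A J H_hilbert f _ _ t (ltW t0) tp_le).
move=> w w_min.
have [Jw fw] :=
  Et_argmin_dual ip A J H_hilbert f _ _ w t t0 tp_le pK Je fE w_min.
have /(ip_eq_norm ip H_hilbert) colinear :
    bracket (dual_path k s) (f - w) = `|A (dual_path k s)| * `|A (f - w)|.
  by rewrite fw mulrA (mulrC _ t) tp mul1r.
have wE : w = f - (`|A (f - w)| / `|A (dual_path k s)|) *: dual_path k s.
  apply: A_injective; rewrite (linearB A) (linearZ_LR A).
  rewrite mulrC -scalerA colinear scalerA mulVf ?gt_eqF// scale1r.
  by rewrite (linearB A) subKr.
by rewrite wE (dual_segment_unique k s _ w k2n s_gt Jw wE) -fe subKr.
Qed.

End spectral.

Theorem corollary4p8 (R : realType) (X0 X H : completeNormedModType R)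
  (ev : X -> X0 -> R) (ip : {dot H for idfun}) (A : {linear X -> H})
  (J : X -> \bar R)
  (X0_separable : separable X0)
  (X_dual : is_dual_of ev)
  (H_hilbert : norm_induced_by ip)
  (A_gelfand : gelfand_embedding A)
  (J_ge0 : forall u, (0 <= J u)%E)
  (J_convex : convex_functional J)
  (J_proper : proper_functional J)
  (J_lsc : lower_semicontinuous (J : weakstar ev -> \bar R))
  (J_homogeneous : abs_homogeneous J)
  (assumption1 : norms_equivalent_on_null_set A J)
  (assumption2 : poincare_inequality A J)
  (assumption3 : weakstar_weak_continuity ev A)
  (n : nat) (gamma lambda : nat -> R) (u : nat -> X) (f : X)
  (Jf_neq0 : J f <> 0%E)
  (f_def : f = \sum_(1 <= i < n.+1) gamma i *: u i)
  (gamma_neq0 : forall i, (1 <= i <= n)%N -> gamma i != 0)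
  (lambda_gt0 : forall i, (1 <= i <= n)%N -> 0 < lambda i)
  (u_neq0 : forall i, (1 <= i <= n)%N -> u i != 0)
  (u_eigen : forall i, (1 <= i <= n)%N ->
     subdiff J (u i) (riesz ip A (A (lambda i *: u i))))
  (u_orthogonal : forall i j, (1 <= i <= n)%N -> (1 <= j <= n)%N -> i != j ->
     ip (A (u i)) (A (u j)) = 0)
  (pk_in_K : forall k, (1 <= k <= n)%N ->
     subdiff J 0 (riesz ip A (A (pk n gamma lambda u k))))
  (ratio_increasing : forall i, (1 <= i < n)%N ->
     `|gamma i| / lambda i < `|gamma i.+1| / lambda i.+1)
  (v : R -> X)
  (v_at0 : v 0 = f)
  (v_min : forall tau, 0 < tau -> argmin [set: X] (Ftau A J f tau) (v tau)) :
  forall (k : nat) (t : R), (1 <= k <= n)%N ->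
    tk A gamma lambda f v k.-1 < t <= tk A gamma lambda f v k ->
    let ut := v (Sk A n gamma lambda u k t) in
    argmin [set: X] (Et A J f t) ut /\
    (* t_1 is excluded from uniqueness: v_tau minimizes E_(t_1) for every
       tau in [0, tau_1] *)
    (t != tk A gamma lambda f v 1 ->
       forall w, argmin [set: X] (Et A J f t) w -> w = ut).
Proof.
move=> k t k1n t_in ut; have A_inj := gelfand_injective A_gelfand.
have [k1|k_neq1] := eqVneq k 1%N.
  subst k; rewrite (_ : ut = f); last by rewrite /ut /Sk eqxx.
  have n1 : (1 <= n)%N by case/andP: k1n.
  by apply: (Et_first_interval ip A J n gamma lambda u f) => //.
have k2n : (1 < k <= n)%N.
  by case/andP: k1n => k1 ->; rewrite ltn_neqAle eq_sym k_neq1 k1.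
have [] : [/\ 0 < t, tauk gamma lambda k.-1 < Sk A n gamma lambda u k t,
    Sk A n gamma lambda u k t <= tauk gamma lambda k &
    t * `|A (dual_path n gamma lambda u k (Sk A n gamma lambda u k t))| = 1].
  exact: (Sk_inverse ip A J n gamma lambda u f
    H_hilbert A_inj J_convex J_homogeneous f_def gamma_neq0 lambda_gt0 u_neq0
    u_eigen u_orthogonal pk_in_K ratio_increasing v v_at0 v_min
    k t k2n t_in).
move=> t0 s_gt s_le tp.
have [ut_min ut_unique] : argmin [set: X] (Et A J f t) ut /\
    (forall w, argmin [set: X] (Et A J f t) w -> w = ut).
  exact: (Et_later_interval ip A J n gamma lambda u f
    H_hilbert A_inj J_convex J_homogeneous f_def gamma_neq0 lambda_gt0 u_neq0
    u_eigen u_orthogonal pk_in_K ratio_increasing v v_at0 v_min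
    k t _ k2n t0 s_gt s_le tp).
by split=> // _.
Qed.
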